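(* Let $\Lambda\colon\mathbb{R}\to[0,1]$ be a function. Then the following three conditions are equivalent: $\liminf_{x\to-\infty}\Lambda(x)>0$; $\;Q_\Lambda^-(F)>-\infty$ for all $F\in\mathcal M$; $\;Q_\Lambda^+(F)>-\infty$ for all $F\in\mathcal M$. If moreover $\Lambda$ is in standard representation, then the following three conditions are equivalent: $\liminf_{x\to\infty}\Lambda(x)<1$; $\;Q_\Lambda^+(F)<\infty$ for all $F\in\mathcal M$; $\;Q_\Lambda^-(F)<\infty$ for all $F\in\mathcal M$.
   Context: $\mathcal M$ is the set of cumulative distribution functions (CDFs) of probability measures on $\mathbb{R}$ (increasing, right-continuous, limit $0$ at $-\infty$ and $1$ at $\infty$). For $\Lambda\colon\mathbb{R}\to[0,1]$ and $F\in\mathcal M$, $Q_\Lambda^-(F):=\inf\{x\in\mathbb{R}\mid F(x)\ge\Lambda(x)\}$ and $Q_\Lambda^+(F):=\inf\{x\in\mathbb{R}\mid F(x)>\Lambda(x)\}$, elements of $[-\infty,\infty]$, with $\inf\varnothing=\infty$. Let $N_0:=\inf\{x\in\mathbb{R}\mid\Lambda(x)=0\}\in[-\infty,\infty]$. $\Lambda$ is in standard representation if $\Lambda(x)=0$ for all $x\in\mathbb R$ with $x>N_0$. *)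

(* Defs.v *)
From mathcomp Require Import all_boot all_order all_algebra.
From mathcomp Require Import all_classical all_reals all_analysis.
Import Order.TTheory GRing.Theory Num.Theory.
Import numFieldNormedType.Exports.

Set Implicit Arguments.
Unset Strict Implicit.
Unset Printing Implicit Defensive.

Local Open Scope classical_set_scope.
Local Open Scope ring_scope.

(* CDFs of probability measures on R are the elements of [cumulativeBounded 0 1]:
   nondecreasing, right-continuous, limit 0 at -oo and 1 at +oo. The library
   makes the Lebesgue-Stieltjes measure of such a function a probability, with
   that function as its cdf ([cdf_lebesgue_stieltjes_id]). *)

Definition Qminus (R : realType) (Lambda F : R -> R) : \bar R :=
  ereal_inf [set x%:E | x in [set x : R | Lambda x <= F x]].

Definition Qplus (R : realType) (Lambda F : R -> R) : \bar R :=
  ereal_inf [set x%:E | x in [set x : R | Lambda x < F x]].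

Definition N0 (R : realType) (Lambda : R -> R) : \bar R :=
  ereal_inf [set x%:E | x in [set x : R | Lambda x = 0]].

Definition standard_representation (R : realType) (Lambda : R -> R) : Prop :=
  forall x : R, (N0 Lambda < x%:E)%E -> Lambda x = 0.

(* Main.v *)
(** The two implications out of the [limf_einf] conditions compare the tails of
    [F], which tend to 0 and 1, with a constant bound on [Lambda] there, and
    [Qminus <= Qplus] gives the middle ones. Conversely, if the liminf at -oo
    is not positive, pick [u n <= - n] with [Lambda (u n) < 1 / (n + 1)]; the
    step CDF [x |-> 1 / (N x + 1)], with [N x] the least [n] such that
    [u n <= x], exceeds [Lambda] at every [u n]. If the liminf at +oo is 1,
    pick [u n >= n] with [Lambda > 1 - 1 / (n + 2)] on [[u n, +oo[]; the step
    CDF [x |-> 1 - 1 / (N x + 1)], with [N x] the least [n] such that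
    [x < u n], vanishes before [u 0] and stays below [Lambda] afterwards. The
    standard representation is what makes [Lambda] positive before [u 0]. *)
Require Import Defs.
From HB Require Import structures.
From mathcomp Require Import all_boot all_order all_algebra.
From mathcomp Require Import all_classical all_reals all_analysis.
Import Order.TTheory GRing.Theory Num.Theory.
Import numFieldNormedType.Exports.

Local Open Scope classical_set_scope.
Local Open Scope ring_scope.

Lemma lte_dense (R : realFieldType) (a b : \bar R) :
  (a < b)%E -> exists r : R, (a < r%:E < b)%E.
Proof.
case: a b => [a| |] [b| |] //= ab.
- rewrite lte_fin in ab.
  by exists ((a + b) / 2); rewrite !lte_fin !midf_lt.
- by exists (a + 1); rewrite lte_fin ltrDl ltr01 ltry.
- by exists (b - 1); rewrite lte_fin gtrBl ltr01 ltNyr.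
- by exists 0; rewrite ltNyr ltry.
Qed.

(** [limf_einf f F] is the supremum, over the members of [F], of the infimum of [f] on them; the
    superlevel set itself serves as the member. *)
Lemma le_limf_einf (R : realType) (T : choiceType)
    (X : filteredType T) (f : X -> \bar R)
    (F : set_system X) (a : \bar R) :
  F [set x | (a <= f x)%E] -> (a <= limf_einf f F)%E.
Proof.
move=> Fa; rewrite limf_einfE.
apply: (@le_trans _ _ (ereal_inf (f @` [set x | (a <= f x)%E]))).
  by apply: le_ereal_inf_tmp => _ [x ax <-].
by apply: ereal_sup_ubound; exists [set x | (a <= f x)%E].
Qed.

Lemma limf_einf_gt (R : realType) (T : choiceType)
    (X : filteredType T) (f : X -> \bar R)
    (F : set_system X) {FF : Filter F} (a : \bar R) :
  (a < limf_einf f F)%E -> F [set x | (a < f x)%E].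
Proof.
rewrite limf_einfE => /ereal_sup_gt[_ [V FV <-] aV].
apply: filterS FV => x Vx /=; apply: (lt_le_trans aV).
by apply: ereal_inf_lbound; exists x.
Qed.

Lemma ex_invSn_le (R : archiRealFieldType) (e : R) :
  0 < e -> exists n : nat, n.+1%:R^-1 <= e.
Proof.
move=> e0; have := near_infty_natSinv_lt (PosNum e0) => /filter_ex[n /= ne].
by exists n; exact: ltW.
Qed.

(** Constancy just to the right of each point gives right-continuity. By monotonicity and the bounds
    0 and 1, a single value within [e] of each bound controls the whole tail, which gives both
    limits. *)
Lemma cdf_of_right_locally_constant (R : realType) (h : R -> R) :
  {homo h : x y / x <= y} ->
  (forall x : R, \forall z \near x^'+, h z = h x) ->
  (forall x : R, 0 <= h x <= 1) ->
  (forall e : R, 0 < e -> exists x : R, h x <= e) ->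
  (forall e : R, 0 < e -> exists x : R, 1 - e <= h x) ->
  exists F : cumulativeBounded (0 : R) (1 : R), h = F.
Proof.
move=> hnd hrc h01 hNy hy.
have rc : right_continuous h by move=> x; apply: cvg_near_cst; exact: hrc.
have cNy : h @ -oo --> (0 : R).
  apply/cvgrPdist_le => e /hNy[x hx]; near=> z.
  have /andP[hz0 _] := h01 z.
  rewrite sub0r normrN ger0_norm//; apply: le_trans hx; apply: hnd.
  by near: z; apply: nbhs_ninfty_le; exact: num_real.
have cy : h @ +oo --> (1 : R).
  apply/cvgrPdist_le => e /hy[x hx]; near=> z.
  have /andP[_ hz1] := h01 z.
  rewrite ger0_norm ?subr_ge0// lerBlDr -lerBlDl; apply: le_trans hx _.
  by apply: hnd; near: z; apply: nbhs_pinfty_ge; exact: num_real.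
pose F1 := isCumulative.Build R _ R h hnd rc.
pose F2 := isCumulativeBounded.Build R 0 1 h cNy cy.
pose F : cumulativeBounded (0 : R) (1 : R) :=
  HB.pack_for (cumulativeBounded (0 : R) (1 : R)) h F1 F2.
by exists F.
Unshelve. all: by end_near. Qed.

Section first_index.
Variables (R : realType) (P : nat -> R -> bool).
Hypothesis exP : forall x : R, exists n, P n x.

Definition first_index (x : R) : nat := ex_minn (exP x).

Lemma first_indexP x : P (first_index x) x.
Proof. by rewrite /first_index; case: ex_minnP. Qed.

Lemma first_index_le n x : P n x -> (first_index x <= n)%N.
Proof. by rewrite /first_index; case: ex_minnP => m _ + /[dup] Pn; apply. Qed.

Lemma first_index_ge n x :
  (forall k, (k < n)%N -> ~~ P k x) -> (n <= first_index x)%N.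
Proof.
move=> Pk; rewrite leqNgt; apply/negP => /Pk.
by rewrite first_indexP.
Qed.

(** Only the finitely many conditions up to [n := first_index x] matter, so they all keep their
    truth value on one right neighborhood of [x]. There [P n] bounds the index of [z] by [n], and
    the condition first met by [z] already holds at [x]. *)
Lemma first_index_near_right :
  (forall n (x : R), \forall z \near x^'+, P n z = P n x) ->
  forall x : R, \forall z \near x^'+, first_index z = first_index x.
Proof.
move=> Prc x; pose n := first_index x.
have near_all : \forall z \near x^'+, forall k : 'I_n.+1, P k z = P k x.
  by apply: filter_forall => k; exact: Prc.
apply: filterS near_all => z Pz.
have zn : (first_index z <= n)%N.
  by apply: first_index_le; rewrite (Pz ord_max) first_indexP.
apply/eqP; rewrite eqn_leq zn first_index_le//.
have := Pz (Ordinal (zn : (first_index z < n.+1)%N)).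
by rewrite /= first_indexP => <-.
Qed.

End first_index.

Arguments first_index {R P}.
Arguments first_indexP {R P}.
Arguments first_index_le {R P}.
Arguments first_index_ge {R P}.
Arguments first_index_near_right {R P}.

Lemma near_right_lt_cst (R : realType) (y x : R) :
  \forall z \near x^'+, (z < y) = (x < y).
Proof.
have [xy|yx] := ltP x y; first exact: nbhs_right_lt.
by near=> z; apply/negbTE; rewrite -leNgt (le_trans yx).
Unshelve. all: by end_near. Qed.

Lemma cdf_gt_frequently_ninfty (R : realType) (L : R -> R) :
  (forall e : R, 0 < e -> ~ \forall x \near -oo, e <= L x) ->
  exists F : cumulativeBounded (0 : R) (1 : R),
    forall A : R, exists2 x : R, x <= A & L x < F x.
Proof.
move=> Le.
(* Otherwise [1 / (n + 1)] would bound [L] from below on the ray before [- n]. *)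
have /choice[u Hu] (n : nat) : exists x : R, x <= - n%:R /\ L x < n.+1%:R^-1.
  apply: contrapT => nex; apply: (Le n.+1%:R^-1) => //.
  exists (- n%:R); split; first exact: num_real.
  move=> x xn; rewrite leNgt; apply/negP => Lx; apply: nex.
  by exists x; rewrite ltW.
have exP (x : R) : exists n, u n <= x.
  exists (Num.bound `|x|); apply: le_trans (proj1 (Hu _)) _.
  rewrite lerNl; apply: le_trans (ler_norm _) _; rewrite normrN.
  exact/ltW/archi_boundP.
pose N := first_index exP.
pose h (x : R) : R := (N x).+1%:R^-1.
have [||||| F hF] := @cdf_of_right_locally_constant _ h.
- move=> x y xy; rewrite lef_pV2 ?posrE// ler_nat ltnS.
  apply: first_index_le; apply: le_trans xy.
  exact: (first_indexP exP).
- move=> x; suff: \forall z \near x^'+, N z = N x.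
    by apply: filterS => z; rewrite /h => ->.
  apply: first_index_near_right => n y.
  by apply: filterS (near_right_lt_cst _ (u n) y) => z; rewrite !leNgt => ->.
- by move=> x; rewrite invr_ge0 ler0n invf_le1 ?ler1n.
- move=> e /ex_invSn_le[n ne].
  (* A point before [u 0], ..., [u (n - 1)] has index at least [n]. *)
  have /filter_ex[x ux] : \forall x \near (-oo : set_system R),
      forall k : 'I_n, x < u k.
    apply: filter_forall => k; apply: nbhs_ninfty_lt; exact: num_real.
  exists x; apply: le_trans ne; rewrite lef_pV2 ?posrE// ler_nat ltnS.
  by apply: first_index_ge => k kn; rewrite -ltNge (ux (Ordinal kn)).
- move=> e e0; exists (u 0); rewrite /h.
  have -> : N (u 0) = 0.
    by apply/eqP; rewrite -leqn0; exact: first_index_le.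
  by rewrite invr1 gerBl ltW.
exists F => A; have [n An] := exP A.
(* The index of [u n] is at most [n], possibly smaller as [u] need not be monotone; hence [h (u n)]
   is at least [1 / (n + 1)]. *)
exists (u n) => //; rewrite -hF; apply: lt_le_trans (proj2 (Hu n)) _.
rewrite lef_pV2 ?posrE// ler_nat ltnS.
exact: first_index_le.
Qed.

Lemma cdf_lt_everywhere (R : realType) (L : R -> R) :
  (forall x : R, 0 < L x) ->
  (forall a : R, a < 1 -> \forall x \near +oo, a < L x) ->
  exists F : cumulativeBounded (0 : R) (1 : R), forall x : R, F x < L x.
Proof.
move=> L0 L1.
(* The shift to [n.+2] matches the value of [h] at index [n + 1], the least index that a point from
   [u n] on may have. *)
have /choice[u Hu] (n : nat) : exists y : R, n%:R <= y /\
    forall x, y <= x -> 1 - n.+2%:R^-1 < L x.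
  have [|M [_ HM]] := L1 (1 - n.+2%:R^-1); first by rewrite gtrBl.
  exists (Num.max n%:R (M + 1)); split; first by rewrite le_max lexx.
  move=> x; rewrite ge_max => /andP[_ Mx]; apply: HM.
  by apply: lt_le_trans Mx; rewrite ltrDl.
have exP (x : R) : exists n, x < u n.
  exists (Num.bound `|x|); apply: lt_le_trans (proj1 (Hu _)).
  by apply: le_lt_trans (ler_norm _) _; exact: archi_boundP.
pose N := first_index exP.
pose h (x : R) : R := 1 - (N x).+1%:R^-1.
have [||||| F hF] := @cdf_of_right_locally_constant _ h.
- move=> x y xy; rewrite lerD2l lerN2 lef_pV2 ?posrE// ler_nat ltnS.
  apply: first_index_le; apply: le_lt_trans xy _.
  exact: (first_indexP exP).
- move=> x; suff: \forall z \near x^'+, N z = N x.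
    by apply: filterS => z; rewrite /h => ->.
  by apply: first_index_near_right => n y; exact: near_right_lt_cst.
- by move=> x; rewrite subr_ge0 gerBl invr_ge0 ler0n invf_le1 ?ler1n.
- move=> e e0; exists (u 0 - 1); rewrite /h.
  have -> : N (u 0 - 1) = 0.
    by apply/eqP; rewrite -leqn0; apply: first_index_le; rewrite gtrBl.
  by rewrite invr1 subrr ltW.
- move=> e /ex_invSn_le[n ne].
  have /filter_ex[x ux] : \forall x \near (+oo : set_system R),
      forall k : 'I_n, u k <= x.
    apply: filter_forall => k; apply: nbhs_pinfty_ge; exact: num_real.
  exists x; rewrite lerD2l lerN2; apply: le_trans ne.
  rewrite lef_pV2 ?posrE// ler_nat ltnS.
  by apply: first_index_ge => k kn; rewrite -leNgt (ux (Ordinal kn)).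
exists F => x; rewrite -hF /h.
(* At index 0, [h x = 0 < L x]. At index [n + 1], minimality gives [u n <= x], where [L] exceeds
   [1 - 1 / (n + 2) = h x]. *)
case Nx : (N x) => [|n]; first by rewrite invr1 subrr.
apply: (proj2 (Hu n)); rewrite leNgt; apply/negP => xn.
by have := first_index_le exP _ _ xn; rewrite -/N Nx ltnn.
Qed.

Lemma Qminus_le_Qplus (R : realType) (L F : R -> R) :
  (Qminus L F <= Qplus L F)%E.
Proof.
by apply: le_ereal_inf => _ [x LF <-]; exists x => //=; exact: ltW.
Qed.

(* A zero of [Lambda] would force [Lambda = 0] on a neighborhood of +oo. *)
Lemma standard_representation_gt0 (R : realType) (L : R -> R) (a : R) :
  (forall x, 0 <= L x) -> standard_representation L -> 0 <= a ->
  (\forall x \near +oo, a < L x) -> forall x, 0 < L x.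
Proof.
move=> L0 srL a0 aL x; rewrite lt_def L0 andbT; apply/eqP => Lx.
have /filter_ex[y [xy]] : \forall y \near +oo, x < y /\ a < L y.
  by apply: filterI => //; apply: nbhs_pinfty_gt; exact: num_real.
rewrite srL; first by rewrite ltNge a0.
apply: le_lt_trans (_ : (x%:E < _)%E); last by rewrite lte_fin.
by apply: ereal_inf_lbound; exists x.
Qed.

Theorem lemma2p3 (R : realType) (Lambda : R -> R)
    (Lambda01 : forall x : R, 0 <= Lambda x <= 1) :
  [<-> (0 < limf_einf (fun x : R => (Lambda x)%:E) -oo%R)%E;
       forall F : cumulativeBounded (0 : R) (1 : R),
         (-oo < Qminus Lambda F)%E;
       forall F : cumulativeBounded (0 : R) (1 : R),
         (-oo < Qplus Lambda F)%E]
  /\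
  (standard_representation Lambda ->
   [<-> (limf_einf (fun x : R => (Lambda x)%:E) +oo%R < 1)%E;
        forall F : cumulativeBounded (0 : R) (1 : R),
          (Qplus Lambda F < +oo)%E;
        forall F : cumulativeBounded (0 : R) (1 : R),
          (Qminus Lambda F < +oo)%E]).
Proof.
split=> [|srL]; tfae.
- move=> /lte_dense[c /andP[c0 /limf_einf_gt cL]] F; rewrite lte_fin in c0.
  have Fc : \forall x \near -oo, F x < c.
    exact: (cvgr_lt _ (cumulativeNy F) _ c0).
  (* Before [A] the constant [c] separates [F] from [Lambda], so [A] is a lower bound of the set
     defining [Qminus]. *)
  have [A [_ HA]] := filterI cL Fc.
  apply: (@lt_le_trans _ _ A%:E); first exact: ltNyr.
  apply: le_ereal_inf_tmp => _ [x LF <-]; rewrite lee_fin leNgt.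
  apply/negP => /HA[/=]; rewrite lte_fin => cLx Fcx.
  by have := lt_le_trans (lt_trans Fcx cLx) LF; rewrite ltxx.
- by move=> Q F; exact: lt_le_trans (Q F) (Qminus_le_Qplus _ _ _).
- move=> Q; apply: contrapT => /negP; rewrite -leNgt => L0.
  have [e e0 eL|F HF] := @cdf_gt_frequently_ninfty _ Lambda.
    have : (e%:E <= limf_einf (fun x => (Lambda x)%:E) -oo%R)%E.
      by apply: le_limf_einf; apply: filterS eL => x; rewrite /= lee_fin.
    by move=> /le_trans/(_ L0); rewrite lee_fin leNgt e0.
  have [r /andP[_ rQ]] := lte_dense _ _ _ (Q F).
  have [x xr LF] := HF r.
  have : (Qplus Lambda F <= x%:E)%E by apply: ereal_inf_lbound; exists x.
  by move=> /(lt_le_trans rQ); rewrite lte_fin ltNge xr.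
- move=> /lte_dense[a /andP[La a1]] F; rewrite lte_fin in a1.
  have Fa : \forall x \near +oo, a < F x.
    exact: (cvgr_gt _ (cumulativey F) _ a1).
  (* If there were no such point, [Lambda] would dominate [F], hence exceed [a] near +oo, against
     [La]. *)
  suff [x LF] : exists x, Lambda x < F x.
    apply: (@le_lt_trans _ _ x%:E); last exact: ltry.
    by apply: ereal_inf_lbound; exists x.
  apply: contrapT => nLF.
  have : (a%:E <= limf_einf (fun x => (Lambda x)%:E) +oo%R)%E.
    apply: le_limf_einf; apply: filterS Fa => x aF /=.
    rewrite lee_fin (le_trans (ltW aF))// leNgt; apply/negP => LF.
    by apply: nLF; exists x.
  by rewrite leNgt La.
- by move=> Q F; exact: le_lt_trans (Qminus_le_Qplus _ _ _) (Q F).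
- move=> Q; apply: contrapT => /negP; rewrite -leNgt => L1.
  have La (a : R) : a < 1 -> \forall x \near +oo, a < Lambda x.
    move=> a1; apply: (@limf_einf_gt _ _ _ (EFin \o Lambda) _ _ a%:E).
    by apply: lt_le_trans L1; rewrite lte_fin.
  have [|//|F HF] := @cdf_lt_everywhere _ Lambda.
    apply: (standard_representation_gt0 _ _ 0) => //; last exact: La.
    by move=> x; have /andP[] := Lambda01 x.
  have := Q F; rewrite /Qminus.
  (* The infimum of the empty set is +oo, which contradicts [Q F]. *)
  suff -> : [set x | Lambda x <= F x] = set0.
    by rewrite image_set0 ereal_inf0 ltxx.
  by apply/seteqP; split=> // x /=; rewrite leNgt HF.
Qed.
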